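(* Let $a_i,b_i$ ($i=1,\dots,6$) and $c_j,d_j$ ($j=1,\dots,6$) be arbitrary real numbers. Let $(O_1,\dots,O_6)=(X_+,X_-,Y_+,Y_-,Z_+,Z_-)$ and $(|\rho_1\rangle,\dots,|\rho_6\rangle)=(|+\rangle,|-\rangle,|+i\rangle,|-i\rangle,|0\rangle,|1\rangle)$, and let $r=(r_{i,j})$ be the $6\times 6$ matrix with rows $$\begin{aligned} r_{1,\cdot}&=\bigl(\tfrac12-a_1-c_1,\;-\tfrac12-a_1-c_2,\;-b_1-c_3,\;-b_1-c_4,\;a_1+b_1-c_5,\;a_1+b_1-c_6\bigr),\\ r_{2,\cdot}&=\bigl(-\tfrac12-a_2-c_1,\;\tfrac12-a_2-c_2,\;-b_2-c_3,\;-b_2-c_4,\;a_2+b_2-c_5,\;a_2+b_2-c_6\bigr),\\ r_{3,\cdot}&=\bigl(-a_3-d_1,\;-a_3-d_2,\;\tfrac12-b_3-d_3,\;-\tfrac12-b_3-d_4,\;a_3+b_3-d_5,\;a_3+b_3-d_6\bigr),\\ r_{4,\cdot}&=\bigl(-a_4-d_1,\;-a_4-d_2,\;-\tfrac12-b_4-d_3,\;\tfrac12-b_4-d_4,\;a_4+b_4-d_5,\;a_4+b_4-d_6\bigr),\\ r_{5,\cdot}&=\bigl(-a_5+c_1+d_1,\;-a_5+c_2+d_2,\;-b_5+c_3+d_3,\;-b_5+c_4+d_4,\;1+a_5+b_5+c_5+d_5,\;a_5+b_5+c_6+d_6\bigr),\\ r_{6,\cdot}&=\bigl(-a_6+c_1+d_1,\;-a_6+c_2+d_2,\;-b_6+c_3+d_3,\;-b_6+c_4+d_4,\;a_6+b_6+c_5+d_5,\;1+a_6+b_6+c_6+d_6\bigr).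 \end{aligned}$$ Then every complex $2\times 2$ matrix $A$ satisfies $$A=\sum_{i=1}^{6}\sum_{j=1}^{6} r_{i,j}\,\mathrm{Tr}[A O_j]\,|\rho_i\rangle\langle\rho_i| .$$
   Context: $|0\rangle,|1\rangle$ is the standard basis of $\mathbb{C}^2$, $|\pm\rangle=(|0\rangle\pm|1\rangle)/\sqrt2$ and $|\pm i\rangle=(|0\rangle\pm i|1\rangle)/\sqrt2$ (eigenstates of the Pauli matrices $X$ and $Y$). The projectors onto the Pauli eigenstates are $X_\pm=|\pm\rangle\langle\pm|$, $Y_\pm=|\pm i\rangle\langle\pm i|$, $Z_+=|0\rangle\langle 0|$, $Z_-=|1\rangle\langle 1|$. *)

(* Defs.v *)
From mathcomp Require Import all_boot all_order all_algebra.
From mathcomp Require Import reals complex.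

Set Implicit Arguments.
Unset Strict Implicit.
Unset Printing Implicit Defensive.

Import GRing.Theory Num.Theory.
Local Open Scope ring_scope.
Local Open Scope complex_scope.

Section Kets.
Variable R : realType.

Definition ket0 : 'cV[R[i]]_2 := delta_mx 0 0.
Definition ket1 : 'cV[R[i]]_2 := delta_mx 1 0.

Definition ket_plus : 'cV[R[i]]_2 := ((Num.sqrt 2)^-1)%:C *: (ket0 + ket1).
Definition ket_minus : 'cV[R[i]]_2 := ((Num.sqrt 2)^-1)%:C *: (ket0 - ket1).
Definition ket_plusi : 'cV[R[i]]_2 :=
  ((Num.sqrt 2)^-1)%:C *: (ket0 + 'i *: ket1).
Definition ket_minusi : 'cV[R[i]]_2 :=
  ((Num.sqrt 2)^-1)%:C *: (ket0 - 'i *: ket1).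

(* |v><v| *)
Definition ketbra (v : 'cV[R[i]]_2) : 'M[R[i]]_2 := v *m (map_mx conjc v)^T.

Definition Xp := ketbra ket_plus.
Definition Xm := ketbra ket_minus.
Definition Yp := ketbra ket_plusi.
Definition Ym := ketbra ket_minusi.
Definition Zp := ketbra ket0.
Definition Zm := ketbra ket1.

Definition obs : 6.-tuple 'M[R[i]]_2 := [tuple Xp; Xm; Yp; Ym; Zp; Zm].

Definition rho : 6.-tuple 'cV[R[i]]_2 :=
  [tuple ket_plus; ket_minus; ket_plusi; ket_minusi; ket0; ket1].

End Kets.

(* Families indexed by 'I_6 start at 0, the subscripts below at 1. *)
Local Notation "a '_[' k ]" := (a (@Ordinal 6 k.-1 isT))
  (at level 2, k at level 200, only parsing).

Definition coef (R : realType) (a b c d : 'I_6 -> R) : 'M[R]_6 :=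
  \matrix_(i, j) nth 0 (nth [::] [::
    [:: 2^-1 - a _[1] - c _[1]; - 2^-1 - a _[1] - c _[2];
        - b _[1] - c _[3]; - b _[1] - c _[4];
        a _[1] + b _[1] - c _[5]; a _[1] + b _[1] - c _[6]];
    [:: - 2^-1 - a _[2] - c _[1]; 2^-1 - a _[2] - c _[2];
        - b _[2] - c _[3]; - b _[2] - c _[4];
        a _[2] + b _[2] - c _[5]; a _[2] + b _[2] - c _[6]];
    [:: - a _[3] - d _[1]; - a _[3] - d _[2];
        2^-1 - b _[3] - d _[3]; - 2^-1 - b _[3] - d _[4];
        a _[3] + b _[3] - d _[5]; a _[3] + b _[3] - d _[6]];
    [:: - a _[4] - d _[1]; - a _[4] - d _[2];
        - 2^-1 - b _[4] - d _[3]; 2^-1 - b _[4] - d _[4];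
        a _[4] + b _[4] - d _[5]; a _[4] + b _[4] - d _[6]];
    [:: - a _[5] + c _[1] + d _[1]; - a _[5] + c _[2] + d _[2];
        - b _[5] + c _[3] + d _[3]; - b _[5] + c _[4] + d _[4];
        1 + a _[5] + b _[5] + c _[5] + d _[5]; a _[5] + b _[5] + c _[6] + d _[6]];
    [:: - a _[6] + c _[1] + d _[1]; - a _[6] + c _[2] + d _[2];
        - b _[6] + c _[3] + d _[3]; - b _[6] + c _[4] + d _[4];
        a _[6] + b _[6] + c _[5] + d _[5]; 1 + a _[6] + b _[6] + c _[6] + d _[6]]
  ] i) j.

(* Main.v *)
Require Import Defs.
From mathcomp Require Import all_boot all_order all_algebra.
From mathcomp Require Import reals complex ring.

Set Implicit Arguments.
Unset Strict Implicit.
Unset Printing Implicit Defensive.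

Import GRing.Theory Num.Theory.
Local Open Scope ring_scope.
Local Open Scope complex_scope.

(** Each projector is [(1 + sigma)/2] or [(1 - sigma)/2] for a Pauli matrix
    [sigma].  Let [H] be the 6 x 4 matrix whose rows are the coordinates of
    twice the projectors in the basis [1, X, Y, Z].  As soon as [H^T r H = 2],
    the double sum is the Pauli expansion
    [A = (1/2) sum_l tr(A sigma_l) sigma_l].  The parameters drop out of
    [H^T r H]: the [a], [b] part of [r] is killed by [H] on the right, and the
    [c], [d] part by [H^T] on the left. *)

Lemma matrix2P (T : Type) (A B : 'M[T]_2) :
  A 0 0 = B 0 0 -> A 0 1 = B 0 1 -> A 1 0 = B 1 0 -> A 1 1 = B 1 1 -> A = B.
Proof.
move=> h00 h01 h10 h11; apply/matrixP => i j.
have ord2 (k : 'I_2) : k = 0 \/ k = 1.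
  by case: k => [[|[|//]]] p; [left | right]; apply: val_inj.
by case: (ord2 i) => ->; case: (ord2 j) => ->.
Qed.

Lemma mxtrace_mulmx2 (K : pzSemiRingType) (A B : 'M[K]_2) :
  \tr (A *m B) =
  A 0 0 * B 0 0 + A 0 1 * B 1 0 + (A 1 0 * B 0 1 + A 1 1 * B 1 1).
Proof.
have sum2 (F : 'I_2 -> K) : \sum_i F i = F 0 + F 1.
  by rewrite !big_ord_recl big_ord0 addr0; congr (_ + F _); apply: val_inj.
by rewrite /mxtrace sum2 !mxE !sum2.
Qed.

Local Notation o_ k := (@Ordinal 6 k isT).

(** The brackets match the three pairs of opposite projectors, so that a pair with zero coordinates
    simplifies away as a block. *)
Lemma big_ord6 (V : nmodType) (F : 'I_6 -> V) :
  \sum_i F i = F (o_ 0) + F (o_ 1) + (F (o_ 2) + F (o_ 3))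
              + (F (o_ 4) + F (o_ 5)).
Proof.
rewrite !big_ord_recl big_ord0 addr0 !addrA.
by do ?[congr (_ + _)]; congr F; apply: val_inj.
Qed.

(** Put [t_l = tr (A sigma_l)]. Expanding the [P j] inside the trace gives
    [tr (A P_j) = (H t)_j / 2]; expanding the outer [P i] then gives the coordinates
    [(H^T r H t)_l / 4 = t_l / 2]. *)
Lemma dual_frame_sum (K : fieldType) (n m p : nat) (sigma : 'I_m -> 'M[K]_p)
    (P : 'I_n -> 'M[K]_p) (H : 'M[K]_(n, m)) (r : 'M[K]_n) (A : 'M[K]_p) :
  2 != 0 :> K ->
  (forall k, P k = 2^-1 *: \sum_l H k l *: sigma l) ->
  H^T *m r *m H = 2%:M ->
  \sum_i \sum_j (r i j * \tr (A *m P j)) *: P i =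
  2^-1 *: \sum_l \tr (A *m sigma l) *: sigma l.
Proof.
move=> two0 PE HrH; pose t := \col_l \tr (A *m sigma l).
have trP j : \tr (A *m P j) = 2^-1 * (H *m t) j 0.
  rewrite PE -scalemxAr mxtraceZ mulmx_sumr raddf_sum /= mxE; congr (_ * _).
  by apply: eq_bigr => l _; rewrite -scalemxAr mxtraceZ mxE.
transitivity (\sum_i (2^-1 * (r *m (H *m t)) i 0) *: P i).
  apply: eq_bigr => i _; rewrite -scaler_suml mxE mulr_sumr; congr (_ *: _).
  by apply: eq_bigr => j _; rewrite trP mulrCA.
transitivity (2^-1 *: \sum_l (2^-1 * (H^T *m (r *m (H *m t))) l 0) *: sigma l).
  rewrite scaler_sumr.
  under [RHS]eq_bigr => l _ do
    rewrite mxE mulr_sumr scaler_suml scaler_sumr.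
  rewrite exchange_big /=; apply: eq_bigr => i _.
  rewrite PE !scaler_sumr; apply: eq_bigr => l _.
  by rewrite !scalerA [H^T _ _]mxE; congr (_ *: _); ring.
rewrite !mulmxA HrH mul_scalar_mx; congr (_ *: _); apply: eq_bigr => l _.
by rewrite !mxE mulrA mulVf ?mul1r.
Qed.

Section PauliMatrices.
(* [w] plays the role of the imaginary unit. *)
Variables (K : fieldType) (w : K).

Definition pauliX : 'M[K]_2 := \matrix_(i, j) (i != j)%:R.
Definition pauliY : 'M[K]_2 :=
  \matrix_(i, j) if i == j then 0 else if i == 0 then - w else w.
Definition pauliZ : 'M[K]_2 :=
  \matrix_(i, j) if i != j then 0 else if i == 0 then 1 else -1.

Definition pauli (l : 'I_4) : 'M[K]_2 :=
  nth 0 [:: 1%:M; pauliX; pauliY; pauliZ] l.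

Lemma pauli_expansion (A : 'M[K]_2) : 2 != 0 :> K -> w ^+ 2 = -1 ->
  A = 2^-1 *: \sum_l \tr (A *m pauli l) *: pauli l.
Proof.
move=> two0 w2; rewrite !big_ord_recl big_ord0 /pauli /= !mxtrace_mulmx2.
(* Each term with [pauliY] has one of its entries from the trace and one as a factor, so [w] enters
   only through [w ^+ 2]. *)
by apply: matrix2P; rewrite !mxE /=; field: w2.
Qed.

End PauliMatrices.

Definition frame_coord (K : pzRingType) : 'M[K]_(6, 4) :=
  \matrix_(k, l) nth 0 (nth [::] [::
    [:: 1; 1; 0; 0]; [:: 1; -1; 0; 0]; [:: 1; 0; 1; 0]; [:: 1; 0; -1; 0];
    [:: 1; 0; 0; 1]; [:: 1; 0; 0; -1]] k) l.

(** Column 0 of the frame is all ones; every other column is [1, -1] on one pair of rows and zero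
    elsewhere. *)
Lemma mulmx_frame_coord (K : pzRingType) m (M : 'M[K]_(m, 6)) i l :
  (M *m frame_coord K) i l =
  nth 0 [:: \sum_k M i k; M i (o_ 0) - M i (o_ 1); M i (o_ 2) - M i (o_ 3);
            M i (o_ 4) - M i (o_ 5)] l.
Proof.
rewrite mxE !big_ord6 !mxE.
by case: l => [[|[|[|[|//]]]]] p /=;
  rewrite ?mulr1 ?mulr0 ?mulrN1 ?addr0 ?add0r.
Qed.

Lemma trmx_frame_coord_mul (K : comPzRingType) m (M : 'M[K]_(6, m)) l j :
  ((frame_coord K)^T *m M) l j =
  nth 0 [:: \sum_k M k j; M (o_ 0) j - M (o_ 1) j; M (o_ 2) j - M (o_ 3) j;
            M (o_ 4) j - M (o_ 5) j] l.
Proof.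
(* The entry is read off the transposed product, where the frame stands on the right. *)
rewrite -[LHS](mxE trmx_key (fun j l => _ l j)) -/(trmx _) trmx_mul trmxK.
rewrite mulmx_frame_coord !mxE; congr ((_ :: _)`_l).
by apply: eq_bigr => k _; rewrite mxE.
Qed.

(** The [a], [b] part of each row, like the [c], [d] part of each column, is constant on pairs and
    has sum zero, so all its frame coordinates vanish. What remains of [r] is block diagonal: the X
    and Y blocks, with [1/2] on and [-1/2] off the diagonal, give the entries 2 at X and Y, and the
    identity block on the Z pair gives those at 1 and Z. *)
Lemma coef_dual (R : realType) (a b c d : 'I_6 -> R) :
  (frame_coord R)^T *m coef a b c d *m frame_coord R = 2%:M.
Proof.
apply/matrixP => l l'; rewrite mulmx_frame_coord.
case: l' => [[|[|[|[|//]]]]] q /=; rewrite ?big_ord6 !trmx_frame_coord_mul;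
  case: l => [[|[|[|[|//]]]]] p /=; rewrite ?big_ord6 !mxE /=; by field.
Qed.

(** Frame coordinates are 0, 1 or -1, hence fixed by ring morphisms. This carries the duality of the
    real matrix [r] over to the complex numbers. *)
Lemma map_frame_dual (K L : pzRingType) (f : {rmorphism K -> L}) (r : 'M[K]_6) :
  (frame_coord K)^T *m r *m frame_coord K = 2%:M ->
  (frame_coord L)^T *m map_mx f r *m frame_coord L = 2%:M.
Proof.
move=> HrH; have -> : frame_coord L = map_mx f (frame_coord K).
  apply/matrixP => k l; rewrite !mxE.
  by case: k => [[|[|[|[|[|[|//]]]]]]] p; case: l => [[|[|[|[|//]]]]] q;
    rewrite ?(rmorph0, rmorphN1, rmorph1).
by rewrite map_trmx -!map_mxM HrH map_scalar_mx rmorph_nat.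
Qed.

Section PauliFrame.
Variable R : realType.
Local Notation K := R[i].
Local Notation sX := (pauliX K).
Local Notation sY := (pauliY ('i : K)).
Local Notation sZ := (pauliZ K).

Lemma ketbraE (v : 'cV[R[i]]_2) i j : ketbra v i j = v i 0 * conjc (v j 0).
Proof. by rewrite /ketbra mxE big_ord1 !mxE. Qed.

Lemma ketbraZ (r : R) (v : 'cV[R[i]]_2) :
  ketbra (r%:C *: v) = (r ^+ 2)%:C *: ketbra v.
Proof.
apply/matrixP => i j; rewrite [RHS]mxE !ketbraE !mxE rmorphM /= oppr0.
by rewrite mulrACA -rmorphM -expr2.
Qed.

Lemma sqr_sqrt2V : ((Num.sqrt 2)^-1 ^+ 2)%:C = 2^-1 :> R[i].
Proof. by rewrite exprVn sqr_sqrtr ?ler0n // fmorphV rmorph_nat. Qed.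

(** The values [1], [-1], ['i], [- 'i] of [z] cover the four eigenstates of X and Y at once. *)
Lemma ketbra_ket0DZE (z : R[i]) i j :
  ketbra (((Num.sqrt 2)^-1)%:C *: (ket0 R + z *: ket1 R)) i j =
  2^-1 * ([:: 1; z]`_i * [:: 1; conjc z]`_j).
Proof.
have ketE (k : 'I_2) : (ket0 R + z *: ket1 R) k 0 = [:: 1; z]`_k.
  by rewrite !mxE; case: k => [[|[|//]]] p /=;
    rewrite ?(mulr0, mulr1, addr0, add0r).
rewrite ketbraZ sqr_sqrt2V mxE ketbraE !ketE; congr (_ * (_ * _)).
by case: j => [[|[|//]]] p; first exact: conjc1.
Qed.

Lemma conjc_i : conjc 'i = - 'i :> R[i].
Proof. by apply/eqP; rewrite eq_complex /= oppr0 !eqxx. Qed.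

Lemma ketbra_plusE : ketbra (ket_plus R) = 2^-1 *: (1%:M + sX).
Proof.
rewrite /ket_plus -[ket1 R]scale1r; apply: matrix2P;
  rewrite ketbra_ket0DZE conjc1 !mxE /=; congr (_ * _);
  by rewrite ?mulr1 ?addr0 ?add0r.
Qed.

Lemma ketbra_minusE : ketbra (ket_minus R) = 2^-1 *: (1%:M - sX).
Proof.
rewrite /ket_minus -[ket1 R]scale1r -scaleNr; apply: matrix2P;
  rewrite ketbra_ket0DZE rmorphN1 !mxE /=; congr (_ * _);
  by rewrite ?mulr1 ?mul1r ?mulrNN ?subr0 ?sub0r ?mulr1.
Qed.

Lemma ketbra_plusiE : ketbra (ket_plusi R) = 2^-1 *: (1%:M + sY).
Proof.
rewrite /ket_plusi; apply: matrix2P;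
  rewrite ketbra_ket0DZE conjc_i !mxE /=; congr (_ * _);
  by rewrite ?mulr1 ?mul1r ?mulrN -?expr2 ?sqr_i ?opprK ?addr0 ?add0r.
Qed.

Lemma ketbra_minusiE : ketbra (ket_minusi R) = 2^-1 *: (1%:M - sY).
Proof.
rewrite /ket_minusi -scaleNr; apply: matrix2P;
  (* Writing [- 'i] as [conjc 'i] lets involutivity compute its conjugate; the last [conjc_i]
     restores the remaining [- 'i]. *)
  rewrite ketbra_ket0DZE -conjc_i conjcK conjc_i !mxE /=; congr (_ * _);
  by rewrite ?mulr1 ?mul1r ?mulNr -?expr2 ?sqr_i ?opprK ?subr0 ?sub0r ?add0r.
Qed.

Lemma ketbra_ket0E : ketbra (ket0 R) = 2^-1 *: (1%:M + sZ).
Proof.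
have two0 : 2 != 0 :> K by rewrite pnatr_eq0.
apply: matrix2P; rewrite ketbraE !mxE !conjc_nat /=;
  by rewrite ?subrr ?addr0 ?mulr0 ?mul0r ?mulVf ?mulr1.
Qed.

Lemma ketbra_ket1E : ketbra (ket1 R) = 2^-1 *: (1%:M - sZ).
Proof.
have two0 : 2 != 0 :> K by rewrite pnatr_eq0.
apply: matrix2P; rewrite ketbraE !mxE !conjc_nat /=;
  by rewrite ?opprK ?subrr ?mulr0 ?mul0r ?mulVf ?mulr1.
Qed.

Lemma ketbra_rho_coord k :
  ketbra (tnth (rho R) k) =
  2^-1 *: \sum_l frame_coord K k l *: pauli 'i l.
Proof.
rewrite !big_ord_recl big_ord0 !mxE /pauli /= addr0.
case: k => [[|[|[|[|[|[|//]]]]]]] p;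
  rewrite [tnth _ _]/= ?(ketbra_plusE, ketbra_minusE, ketbra_plusiE,
    ketbra_minusiE, ketbra_ket0E, ketbra_ket1E) /=;
  by rewrite ?(scale1r, scale0r, scaleN1r, addr0, add0r).
Qed.

Lemma tnth_obs k : tnth (obs R) k = ketbra (tnth (rho R) k).
Proof. by case: k => [[|[|[|[|[|[|//]]]]]]] p. Qed.

End PauliFrame.

Theorem mainTheorem4 (R : realType) (a b c d : 'I_6 -> R) (A : 'M[R[i]]_2) :
  A = \sum_(i < 6) \sum_(j < 6)
        ((coef a b c d i j)%:C * \tr (A *m tnth (obs R) j))
          *: ketbra (tnth (rho R) i).
Proof.
have two0 : 2 != 0 :> R[i] by rewrite pnatr_eq0.
have coefC := map_frame_dual (real_complex R) (coef_dual a b c d).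
rewrite [LHS](pauli_expansion A two0 (sqr_i R)).
rewrite -(dual_frame_sum A two0 (@ketbra_rho_coord R) coefC).
by apply: eq_bigr => i _; apply: eq_bigr => j _; rewrite mxE tnth_obs.
Qed.
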